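(* Let $p\ge 3$ be a prime and let $r$ be an integer with $1\le r\le p-1$ such that $8r+1$ is a quadratic non-residue modulo $p$. Then for all integers $n\ge 0$ and all integers $k\ge j\ge 0$, \[ a_{p(k-j)+(p-1),\;pk+(p+1)}(pn+r)\equiv 0 \pmod p. \]
   Context: For positive integers $r,s$, $a_{r,s}(n)$ denotes the number of multicolored partitions of $n$ in which each even part may appear in one of $r$ colors and each odd part may appear in one of $s$ colors (copies of the same part size in different colors are distinct), with $a_{r,s}(0)=1$. Equivalently, for $|q|<1$, $\sum_{n\ge0}a_{r,s}(n)q^n = f_2^{s-r}/f_1^{s}$, where $f_m=\prod_{i\ge1}(1-q^{mi})$. *)

(* Defs.v *)
From HB Require Import structures.
From mathcomp Require Import all_boot.

Set Implicit Arguments.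
Unset Strict Implicit.
Unset Printing Implicit Defensive.

Definition num_colors (r s i : nat) : nat := if odd i then s else r.

(* [Tagged _ c] with tag [i : 'I_n] is the part of size [i.+1] in color [c]. *)
Definition colored_part (r s n : nat) : finType :=
  {i : 'I_n & 'I_(num_colors r s i.+1)}.

Definition part_size (r s n : nat) (x : colored_part r s n) : nat := (tag x).+1.

(* A multicolored partition of [n] is given by the multiplicity of each colored
   part; its parts have size at most [n] and its multiplicities are at most
   [n], so the bounds in the two ordinal types exclude nothing. *)
Definition multicolored_partitions (r s n : nat) :
    {set {ffun colored_part r s n -> 'I_n.+1}} :=
  [set m : {ffun colored_part r s n -> 'I_n.+1}
    | \sum_(x : colored_part r s n) m x * part_size x == n].

Definition a (r s n : nat) : nat := #|multicolored_partitions r s n|.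

Definition quadratic_nonresidue (p b : nat) : Prop :=
  coprime b p /\ ~ (exists x : nat, x ^ 2 = b %[mod p]).

(* Main.v *)
Require Import Defs.
From mathcomp Require Import all_boot.
From mathcomp Require Import all_order all_algebra qpoly ring zify.

(** Put [psi(q) = sum_m q^(m(m+1)/2)] and [f_m = prod_i (1 - q^(m i))].
    Gauss's identity [f_2^2 / f_1 = psi(q)] and the congruence
    [g(q)^p = g(q^p) mod p] show that, modulo [p], the generating function
    [f_2^(pj+2) / f_1^(pk+p+1)] is [psi(q)] times a series in [q^p].  A nonzero
    coefficient at [q^(pn+r)] would thus give [r = m(m+1)/2 mod p], that is
    [8r+1 = (2m+1)^2 mod p].

    Gauss's identity is obtained from a finite identity of Shanks ("Two theorems
    of Gauss", Pacific J. Math. 8, 1958).  Power series truncated after [q^N] are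
    represented by a commutative ring with an element [x] with
    [x ^+ N.+1 = 0]. *)

Set Implicit Arguments.
Unset Strict Implicit.
Unset Printing Implicit Defensive.
Import GRing.Theory.
Local Open Scope ring_scope.

Definition oddprod (S : comNzRingType) (x : S) (n : nat) : S :=
  \prod_(t < n) (1 - x ^+ t.*2.+1).

(** The lower bound [s] makes this the quotient of two products starting at 0, so that Shanks's
    identity needs no division. *)
Definition evenprod (S : comNzRingType) (x : S) (s n : nat) : S :=
  \prod_(s <= t < n) (1 - x ^+ t.*2.+2).

Definition triseries (S : comNzRingType) (x : S) (n : nat) : S :=
  \sum_(i < n) x ^+ 'C(i.+1, 2).

(** Truncated inverse of [1 - x ^+ i.+1]; the term [m] records a part of size [i.+1] taken [m]
    times. *)
Definition geom (S : comNzRingType) (x : S) (N i : nat) : S :=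
  \sum_(m < N.+1) x ^+ (m * i.+1).

(* The summands are the differences of the right-hand side in [m]. *)
Lemma shanks_telescope (S : comNzRingType) (x : S) (n m : nat) : (m <= n)%N ->
  \sum_(s < m.+1) evenprod x s n * oddprod x s * x ^+ (s * n.*2.+1)
     * ((1 - x ^+ n.*2.+2) * x ^+ s.*2 - (1 - x ^+ n.*2.+1))
  = evenprod x m n * oddprod x m.+1 * x ^+ (m.+1 * n.*2.+1).
Proof.
elim: m => [_|m IHm ltmn].
  rewrite big_ord1 /oddprod big_ord0 big_ord1 mul0n mul1n !exprS.
  by rewrite /=; ring.
rewrite big_ord_recr /= IHm ?(ltnW ltmn) //.
rewrite /evenprod (big_ltn ltmn) -/(evenprod x m.+1 n).
rewrite [oddprod x m.+2]/oddprod big_ord_recr /= -/(oddprod x m.+1).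
have -> : x ^+ (m.+2 * n.*2.+1) = x ^+ (m.+1 * n.*2.+1) * x ^+ n.*2.+1.
  by rewrite -exprD; congr (_ ^+ _); lia.
rewrite doubleS !exprS; ring.
Qed.

Lemma shanks_identity (S : comNzRingType) (x : S) (n : nat) :
  oddprod x n * triseries x n.*2
  = \sum_(s < n) evenprod x s n * oddprod x s * x ^+ (s * n.*2.+1).
Proof.
elim: n => [|n IHn]; first by rewrite /triseries !big_ord0 mulr0.
have evenS (s : nat) : (s <= n)%N ->
    evenprod x s n.+1 = evenprod x s n * (1 - x ^+ n.*2.+2).
  by move=> lesn; rewrite /evenprod big_nat_recr.
(* This is the left-hand side at [n.+1]. Of its two new triangular exponents, [n * n.*2.+1] supplies
   the summand [s = n], and [n.+1 * n.*2.+1] gives the boundary term that [shanks_telescope] expands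
   into a sum. *)
transitivity ((1 - x ^+ n.*2.+1) *
    \sum_(s < n.+1) evenprod x s n * oddprod x s * x ^+ (s * n.*2.+1)
    + evenprod x n n * oddprod x n.+1 * x ^+ (n.+1 * n.*2.+1)).
  rewrite big_ord_recr /= -IHn /evenprod big_geq // !mul1r.
  rewrite /triseries doubleS !big_ord_recr /= -/(triseries x _).
  rewrite /oddprod big_ord_recr /= -/(oddprod x n).
  have -> : 'C(n.*2.+1, 2) = (n * n.*2.+1)%N by rewrite bin2; lia.
  have -> : 'C(n.*2.+2, 2) = (n.+1 * n.*2.+1)%N by rewrite bin2; lia.
  ring.
rewrite -shanks_telescope // mulr_sumr -big_split /=.
apply: eq_bigr => s _; rewrite evenS; last by rewrite -ltnS.
have -> : x ^+ (s * n.+1.*2.+1) = x ^+ (s * n.*2.+1) * x ^+ s.*2.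
  by rewrite -exprD; congr (_ ^+ _); lia.
ring.
Qed.

Lemma expr_ge_nil (S : comNzRingType) (x : S) (n m : nat) :
  x ^+ n = 0 -> (n <= m)%N -> x ^+ m = 0.
Proof. by move=> xn0 lenm; rewrite -(subnK lenm) exprD xn0 mulr0. Qed.

Lemma geomK (S : comNzRingType) (x : S) (N i : nat) :
  x ^+ N.+1 = 0 -> (1 - x ^+ i.+1) * geom x N i = 1.
Proof.
move=> xN0; rewrite /geom.
under eq_bigr => m _ do rewrite mulnC exprM.
rewrite -opprB mulNr -subrX1 -exprM (expr_ge_nil xN0) ?sub0r ?opprK //.
by rewrite mulSn leq_addr.
Qed.

(** In Shanks's sum the exponent [s * N.*2.+1] exceeds [N] for [s > 0], so only [s = 0] survives. *)
Lemma gauss_truncated (S : comNzRingType) (x : S) (N : nat) :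
  (0 < N)%N -> x ^+ N.+1 = 0 ->
  oddprod x N * triseries x N.*2 = evenprod x 0 N.
Proof.
rewrite shanks_identity; case: N => [|N] // _ xN0.
rewrite big_ord_recl big1 => [|i _].
  by rewrite addr0 /oddprod big_ord0 mul0n expr0 !mulr1.
by rewrite (expr_ge_nil xN0) ?mulr0 //= /bump /=; nia.
Qed.

Lemma prod_ord_double (S : comNzRingType) (n : nat) (F : nat -> S) :
  \prod_(i < n.*2) F i = \prod_(i < n) (F i.*2 * F i.*2.+1).
Proof.
elim: n => [|n IHn]; first by rewrite !big_ord0.
by rewrite doubleS !big_ord_recr /= IHn mulrA.
Qed.

(** Even sizes contribute [f_2] and odd sizes [f_2 / f_1], so the product is [f_2^2 / f_1]. *)
Lemma gauss_geom (S : comNzRingType) (x : S) (N : nat) :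
  (0 < N)%N -> x ^+ N.+1 = 0 ->
  \prod_(i < N) (if odd i.+1 then geom x N i else 1 - x ^+ i.+1)
  = triseries x N.*2.
Proof.
move=> N_gt0 xN0.
pose e (i : nat) : S := if odd i.+1 then geom x N i else 1 - x ^+ i.+1.
have e1 i : (N <= i)%N -> e i = 1.
  move=> leNi; have xi0 := expr_ge_nil (m := i.+1) xN0 leNi.
  have := geomK i xN0.
  by rewrite /e xi0 subr0 mul1r => ->; rewrite if_same.
(* The added factors are 1; the [N] pairs of an odd and an even size now match [oddprod x N] and
   [evenprod x 0 N]. *)
transitivity (\prod_(i < N.*2) e i).
  rewrite -(big_mkord xpredT e) -(big_mkord xpredT e).
  rewrite [RHS](@big_cat_nat _ _ _ N) //= -?addnn ?leq_addr //.
  rewrite [X in _ = _ * X]big_nat_cond [X in _ = _ * X]big1 ?mulr1 // => i.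
  by case/andP=> /andP[/e1].
rewrite prod_ord_double big_split /=.
rewrite (_ : \prod_(i < N) e i.*2.+1 = evenprod x 0 N); last first.
  rewrite /evenprod big_mkord; apply: eq_bigr => i _.
  by rewrite /e /= odd_double.
rewrite -gauss_truncated // mulrA /oddprod -big_split big1 /= ?mul1r // => i _.
by rewrite mulrC /e /= odd_double /= geomK.
Qed.

(** The exponents are [p * c.+1 + 1] at odd sizes and [p * b.+1 - 1] at even ones. Beyond the [p]-th
    power, this leaves one [geom] or one inverse of it, which are the factors in [gauss_geom]. *)
Lemma colored_product (S : comNzRingType) (x : S) (N p b c : nat) :
  (0 < N)%N -> x ^+ N.+1 = 0 -> (0 < p)%N ->
  \prod_(i < N) geom x N i ^+ num_colors (p * b + (p - 1)) (p * c + (p + 1)) i.+1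
  = (\prod_(i < N) geom x N i ^+ (if odd i.+1 then c.+1 else b.+1)) ^+ p
    * triseries x N.*2.
Proof.
move=> N_gt0 xN0 p_gt0; rewrite -gauss_geom // -prodrXl -big_split /=.
apply: eq_bigr => i _; rewrite /num_colors /= -exprM.
case: (odd i) => /=; last by rewrite -exprSr; congr (_ ^+ _); lia.
have -> : (b.+1 * p = (p * b + (p - 1)).+1)%N by lia.
by rewrite exprSr -mulrA [_ * (1 - _)]mulrC geomK ?mulr1.
Qed.

Lemma rmorph_geom (S T : comNzRingType) (f : {rmorphism S -> T}) (x : S)
  (N i : nat) : f (geom x N i) = geom (f x) N i.
Proof. by rewrite rmorph_sum; apply: eq_bigr => m _; rewrite rmorphXn. Qed.

Lemma rmorph_triseries (S T : comNzRingType) (f : {rmorphism S -> T}) (x : S)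
  (n : nat) : f (triseries x n) = triseries (f x) n.
Proof. by rewrite rmorph_sum; apply: eq_bigr => m _; rewrite rmorphXn. Qed.

Lemma coef_eq_in_qpolyXn (A : comNzRingType) (n i : nat) (P Q : {poly A}) :
  (i <= n)%N -> in_qpoly 'X^(n.+1) P = in_qpoly 'X^(n.+1) Q -> P`_i = Q`_i.
Proof.
move=> lein /(congr1 val) /=; rewrite !mk_monic_Xn /= => eqPQ.
rewrite [P](Pdiv.RingMonic.rdivp_eq (monicXn A n.+1)).
rewrite [Q](Pdiv.RingMonic.rdivp_eq (monicXn A n.+1)).
by rewrite !coefD !coefMXn ltnS lein eqPQ.
Qed.

(** The class of ['X] modulo ['X^(N.+1)] satisfies the nilpotency hypothesis, and the quotient
    retains the coefficient at [N]. *)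
Lemma coef_colored_product (A : comNzRingType) (N p b c : nat) :
  (0 < N)%N -> (0 < p)%N ->
  (\prod_(i < N) geom 'X N i
     ^+ num_colors (p * b + (p - 1)) (p * c + (p + 1)) i.+1)`_N
  = ((\prod_(i < N) geom 'X N i ^+ (if odd i.+1 then c.+1 else b.+1)) ^+ p
    * triseries ('X : {poly A}) N.*2)`_N.
Proof.
move=> N_gt0 p_gt0; apply: (@coef_eq_in_qpolyXn _ N) => //.
pose f : {rmorphism {poly A} -> {poly %/ 'X^(N.+1)}} := in_qpoly 'X^(N.+1).
have xN0 : f 'X ^+ N.+1 = 0.
  rewrite -rmorphXn; apply: val_inj => /=; rewrite mk_monic_Xn /=.
  by rewrite Pdiv.RingMonic.rmodpp // monicXn.
rewrite -!/(f _) rmorphM rmorphXn !rmorph_prod rmorph_triseries.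
under eq_bigr => i _ do rewrite rmorphXn /= rmorph_geom.
under [in RHS]eq_bigr => i _ do rewrite rmorphXn /= rmorph_geom.
exact: colored_product.
Qed.

Lemma a_genfun (A : comNzRingType) (r s N : nat) :
  (a r s N)%:R
  = (\prod_(i < N) geom ('X : {poly A}) N i ^+ num_colors r s i.+1)`_N.
Proof.
transitivity ((\prod_(y : colored_part r s N)
    \sum_(m < N.+1) ('X : {poly A}) ^+ (m * part_size y))`_N).
  (* Expanding the product gives one monomial per choice of multiplicities, with the partitioned
     total as exponent. *)
  rewrite bigA_distr_bigA coef_sum /a -sum1_card natr_sum.
  rewrite [LHS]big_mkcond /=; apply: eq_bigr => m _.
  by rewrite inE prodrXr coefXn eq_sym; case: eqP.
apply: (congr1 (fun P : {poly A} => P`_N)).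
transitivity (\prod_(i < N) \prod_(j < num_colors r s i.+1)
    geom ('X : {poly A}) N i); last first.
  by apply: eq_bigr => i _; rewrite prodr_const card_ord.
by rewrite (sig_big_dep xpredT (fun _ => xpredT)
  (fun (i : 'I_N) (_ : 'I_(num_colors r s i.+1)) => geom ('X : {poly A}) N i)).
Qed.

Lemma expr_pchar_poly (A : comNzRingType) (p : nat) (P : {poly A}) :
  p \in [pchar A] -> P ^+ p = \sum_(i < size P) P`_i ^+ p *: 'X^(i * p).
Proof.
move=> charA; have charPA : p \in [pchar {poly A}] by rewrite pchar_poly.
rewrite -{1}[P]coefK poly_def -(pFrobenius_autE charPA) rmorph_sum.
apply: eq_bigr => i _.
by rewrite [LHS]pFrobenius_autE exprZn -exprM.
Qed.

Local Close Scope ring_scope.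

Theorem theorem1p17 (p r : nat) (p_prime : prime p) (p_ge3 : 3 <= p)
    (r_bounds : 1 <= r <= p - 1)
    (nonres : quadratic_nonresidue p (8 * r + 1))
    (n k j : nat) (le_jk : j <= k) :
  a (p * (k - j) + (p - 1)) (p * k + (p + 1)) (p * n + r) = 0 %[mod p].
Proof.
have p_gt0 : 0 < p by exact: prime_gt0.
rewrite mod0n -val_Fp_nat // a_genfun coef_colored_product //; last first.
  by case/andP: r_bounds => r_gt0 _; rewrite addn_gt0 r_gt0 orbT.
rewrite expr_pchar_poly ?pchar_Fp // mulr_suml coef_sum big1 //= => i _.
rewrite /triseries mulr_sumr coef_sum big1 //= => m _.
rewrite -scalerAl coefZ -exprD coefXn; case: eqP => [eN|]; last by rewrite mulr0.
case: nonres => _ []; exists (2 * m + 1).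
(* Eight times [eN], plus one, since [(2 * m + 1) ^ 2 = 8 * 'C(m.+1, 2) + 1]. *)
have e8 : (2 * m + 1) ^ 2 + 8 * i * p = 8 * r + 1 + 8 * n * p.
  have : m.+1 * m = 2 * 'C(m.+1, 2) by rewrite -mul_bin_diag bin1.
  by move: eN; rewrite expnS expn1; nia.
by rewrite -(modnMDl (8 * i) _ p) addnC e8 addnC modnMDl.
Qed.
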